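(* Fix a recursive representation of the universal poset $\mathbb{P}=(\mathbb{N},\prec)$ on the natural numbers $\mathbb{N}$. Let $\mathcal{M}(\mathbb{P})$ be the class of linear extensions of $\mathbb{P}$, i.e. the set of total orders $\xi$ on $\mathbb{N}$ such that $x\prec y$ implies $x<_\xi y$ for all $x,y\in\mathbb{N}$. Let $ML_\mu$ be the set of total orders on $\mathbb{N}$ that are Martin-Löf random relative to the Glasner-Weiss probability measure $\mu$. Then $$ML_\mu\cap\mathcal{M}(\mathbb{P})=\emptyset.$$
   Context: The universal poset $\mathbb{P}$ is the Fraïssé limit of the class of finite posets: the countable homogeneous poset, unique up to isomorphism, into which every finite poset embeds (homogeneous: every isomorphism between finite substructures extends to an automorphism). A recursive representation of it on $\mathbb{N}$ is a copy of it with underlying set $\mathbb{N}$ whose strict order relation $\prec$ is a recursive (decidable) relation on $\mathbb{N}^2$. $\mathcal{M}$ is the set of (strict) total orders on $\mathbb{N}$, identified with a closed subset of the compact product space $\{0,1\}^{(\mathbb{N}\times\mathbb{N})_{\neq}}$, where $(\mathbb{N}\times\mathbb{N})_{\neq}$ is the set of pairs $(i,j)$ with $i\neq j$: a total order $<$ corresponds to $\xi$ with $\xi(x,y)=1\Leftrightarrow x<y$, and one writes $<_\xi$ for the order associated with $\xi$. $S_\infty$ is the group of all permutations of $\mathbb{N}$ with the topology of pointwise convergence; it acts continuously on $\mathcal{M}$ by $x<_{\sigma\xi}y\Leftrightarrow \sigma^{-1}x<_\xi\sigma^{-1}y$. The Glasner-Weiss measure $\mu$ is the unique $S_\infty$-invariant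 Borel probability measure on $\mathcal{M}$ (its existence and uniqueness are known). $\mathcal{M}_f$ is the set of total orders on finite subsets of $\mathbb{N}$. For $\ell\in\mathcal{M}_f$, the cylinder set $Z_\ell$ is the set of $\xi\in\mathcal{M}$ extending $\ell$. $\mathcal{Z}$ is the algebra of subsets of $\mathcal{M}$ generated by the sets $Z_\ell$, $\ell\in\mathcal{M}_f$. For a cylinder set $Z$ write $Z^1=Z$ and $Z^0=\mathcal{M}\setminus Z$. A recursive representation of $\mathcal{Z}$ is an enumeration $(T_i)_{i\in\mathbb{N}}$ of $\mathcal{Z}$ such that from a given $i$ one can effectively retrieve an expression of $T_i$ as a finite union of sets of the form $Z_{\ell_1}^{\delta_1}\cap\cdots\cap Z_{\ell_k}^{\delta_k}$ with each $\ell_j\in\mathcal{M}_f$ and $\delta_j\in\{0,1\}$. A set $A\subset\mathcal{M}$ is of constructive measure $0$ if, for some recursive representation $(T_i)_{i\in\mathbb{N}}$ of $\mathcal{Z}$, there is a total recursive $\phi:\mathbb{N}^2\to\mathbb{N}$ such that $A\subset\bigcap_n\bigcup_m T_{\phi(n,m)}$ and $\mu\left(\bigcup_m T_{\phi(n,m)}\right)$ converges effectively to $0$ as $n\to\infty$ (i.e. there is a total recursive $g$ such that this measure is $<2^{-k}$ for all $n\geq g(k)$). A total order $\xi\in\mathcal{M}$ is $\mu$-Martin-Löf random (Martin-Löf random relative to $\mu$) if $\xi$ lies in the complement of every subset of $\mathcal{M}$ of constructive measure $0$. *)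

(* Defs.v *)
(* MathComp / MathComp-Analysis *)
From HB Require Import structures.
From mathcomp Require Import all_boot all_order all_algebra.
From mathcomp Require Import all_classical all_reals all_analysis.
Set Implicit Arguments.
Unset Strict Implicit.
Unset Printing Implicit Defensive.
Import Order.TTheory GRing.Theory Num.Theory.
Local Open Scope classical_set_scope.

(** ** Recursive functions *)

(* Programs for the partial recursive functions of [k] arguments. *)
Inductive recprog : nat -> Type :=
| RZero k : recprog k
| RSucc : recprog 1
| RProj k (i : 'I_k) : recprog k
| RComp k m (f : recprog m) (g : 'I_m -> recprog k) : recprog k
| RPrim k (f : recprog k) (g : recprog k.+2) : recprog k.+1
| RMin k (f : recprog k.+1) : recprog k.

(* [receval p v y]: on input [v], the program [p] halts with output [y]. *)
Inductive receval : forall k, recprog k -> k.-tuple nat -> nat -> Prop :=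
| eval_zero k (v : k.-tuple nat) : receval (RZero k) v 0
| eval_succ (v : 1.-tuple nat) : receval RSucc v (tnth v ord0).+1
| eval_proj k (i : 'I_k) (v : k.-tuple nat) : receval (RProj i) v (tnth v i)
| eval_comp k m (f : recprog m) (g : 'I_m -> recprog k) (v : k.-tuple nat)
    (w : m.-tuple nat) y :
    (forall i, receval (g i) v (tnth w i)) -> receval f w y ->
    receval (RComp f g) v y
| eval_prim0 k (f : recprog k) (g : recprog k.+2) (v : k.-tuple nat) y :
    receval f v y -> receval (RPrim f g) (cons_tuple 0 v) y
| eval_primS k (f : recprog k) (g : recprog k.+2) (v : k.-tuple nat) n y z :
    receval (RPrim f g) (cons_tuple n v) y ->
    receval g (cons_tuple n (cons_tuple y v)) z ->
    receval (RPrim f g) (cons_tuple n.+1 v) z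
| eval_min k (f : recprog k.+1) (v : k.-tuple nat) n (w : nat -> nat) :
    (forall i, i < n -> receval f (cons_tuple i v) (w i).+1) ->
    receval f (cons_tuple n v) 0 ->
    receval (RMin f) v n.

Definition total_recursive1 (F : nat -> nat) : Prop :=
  exists p : recprog 1, forall x, receval p [tuple x] (F x).

Definition total_recursive2 (F : nat -> nat -> nat) : Prop :=
  exists p : recprog 2, forall x y, receval p [tuple x; y] (F x y).

Definition recursive_rel (r : rel nat) : Prop :=
  total_recursive2 (fun x y => nat_of_bool (r x y)).

(** ** The universal poset *)

Definition Sinf := {splitbij [set: nat] >-> [set: nat]}.

Definition strict_order (prec : rel nat) : Prop :=
  irreflexive prec /\ transitive prec.

(* [f] is only used on the finite set of elements of [A]. *)
Definition homogeneous (prec : rel nat) : Prop :=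
  forall (A : seq nat) (f : nat -> nat),
    {in A &, injective f} ->
    {in A &, forall x y, prec (f x) (f y) = prec x y} ->
    exists s : Sinf,
      (forall x y, prec (s x) (s y) = prec x y) /\ {in A, s =1 f}.

Definition embeds_finite_posets (prec : rel nat) : Prop :=
  forall (d : Order.disp_t) (T : finPOrderType d),
    exists f : T -> nat,
      injective f /\ forall x y : T, prec (f x) (f y) = (x < y)%O.

Definition universal_poset (prec : rel nat) : Prop :=
  [/\ strict_order prec, homogeneous prec & embeds_finite_posets prec].

(** ** The space of total orders *)

Definition npair := {p : nat * nat | p.1 != p.2}.

Definition ltr_of (xi : npair -> bool) : rel nat :=
  fun x y => if insub (x, y) is Some p then xi p else false.

Definition strict_total (r : rel nat) : Prop :=
  [/\ irreflexive r, transitive r & forall x y, x != y -> r x y || r y x].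

Definition total_orders : set {ptws npair -> bool} :=
  [set xi | strict_total (ltr_of xi)].

(* A set used as a type carries the topology induced from the ambient space. *)
Definition orders : Type := total_orders.
HB.instance Definition _ := Topological.copy orders (set_type total_orders).

Definition olt (xi : orders) : rel nat := ltr_of (set_val xi).

Lemma oltP (xi : orders) : strict_total (olt xi).
Proof. exact: set_mem (valP xi). Qed.

Definition of_rel (r : rel nat) : {ptws npair -> bool} :=
  fun p => r (val p).1 (val p).2.

Lemma of_relK (r : rel nat) : irreflexive r -> ltr_of (of_rel r) =2 r.
Proof.
move=> ir x y; rewrite /ltr_of; case: insubP => [p _ vp|].
  by rewrite /of_rel vp.
by rewrite negbK /= => /eqP ->; rewrite ir.
Qed.

Lemma of_rel_total (r : rel nat) :
  strict_total r -> of_rel r \in total_orders.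
Proof.
move=> [ir tr cr]; apply/mem_set; split=> [x|y x z|x y];
  rewrite !of_relK //; [exact: tr|exact: cr].
Qed.

Definition order_of (r : rel nat) (rP : strict_total r) : orders :=
  exist _ (of_rel r) (of_rel_total rP).

Lemma ltn_strict_total : strict_total ltn.
Proof.
by split=> [x|y x z|x y]; [exact: ltnn|exact: ltn_trans|rewrite neq_ltn].
Qed.

HB.instance Definition _ := isPointed.Build orders (order_of ltn_strict_total).

Lemma act_subproof (s : Sinf) (xi : orders) :
  strict_total (fun x y => olt xi (s^-1%FUN x) (s^-1%FUN y)).
Proof.
have [ir tr cr] := oltP xi; split=> [x|y x z|x y xy]; [exact: ir|exact: tr|].
apply: cr; apply: contraNneq xy => /(congr1 s).
by rewrite !invK ?inE// => ->.
Qed.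

(* [x < y] in [act s xi] iff [s^-1 x < s^-1 y] in [xi]. *)
Definition act (s : Sinf) (xi : orders) : orders := order_of (act_subproof s xi).

Definition borel_orders := g_sigma_algebraType (@open orders).

(* The Glasner-Weiss measure is the only Borel probability measure on the
   space of total orders with this property. *)
Definition glasner_weiss (R : realType) (mu : probability borel_orders R) :
    Prop :=
  forall (s : Sinf) (A : set borel_orders),
    measurable A -> mu (act s @` A) = mu A.

(** ** Cylinders and the algebra they generate *)

(* A total order on a finite subset of [nat], as the list of the elements of
   that subset in increasing order. *)
Definition fin_order := {l : seq nat | uniq l}.

Definition cylinder (l : fin_order) : set orders :=
  [set xi | {in val l &, forall x y,
     olt xi x y = (index x (val l) < index y (val l))}].

Definition set_algebra (T : Type) (G : set (set T)) : Prop :=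
  setring G /\ G setT.

Definition cyl_algebra : set (set orders) :=
  smallest (@set_algebra orders) (range cylinder).

Definition literal (a : fin_order * bool) : set orders :=
  if a.2 then cylinder a.1 else ~` cylinder a.1.

(* A finite union of finite intersections of literals. *)
Definition expression := seq (seq (fin_order * bool)).

Definition denote (e : expression) : set orders :=
  \big[setU/set0]_(c <- e) \big[setI/setT]_(a <- c) literal a.

(* Expressions are coded by natural numbers through the standard [pickle]:
   [true] and [false] are coded by 1 and 0, a pair by the code of the list of
   its two components, and the list of the objects coded by n1, ..., nk by
   [CodeSeq.code [:: n1; ...; nk]]. *)
Definition recursive_representation (T : nat -> set orders) : Prop :=
  range T = cyl_algebra /\
  exists E : nat -> expression,
    total_recursive1 (fun i => pickle (E i)) /\ forall i, T i = denote (E i).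

(** ** Randomness *)

Definition converges_effectively_to0 (R : realType) (u : nat -> \bar R) : Prop :=
  exists g : nat -> nat, total_recursive1 g /\
    forall k n, g k <= n -> (u n < ((2 ^- k)%R : R)%:E)%E.

Definition constructive_measure0 (R : realType)
    (mu : probability borel_orders R) (A : set orders) : Prop :=
  exists T : nat -> set orders, recursive_representation T /\
  exists phi : nat -> nat -> nat,
    [/\ total_recursive2 phi,
        A `<=` \bigcap_n \bigcup_m T (phi n m) &
        converges_effectively_to0 (fun n => mu (\bigcup_m T (phi n m)))].

Definition martin_lof_random (R : realType) (mu : probability borel_orders R) :
    set orders :=
  [set xi | forall A, constructive_measure0 mu A -> (~` A) xi].

Definition linear_extensions (prec : rel nat) : set orders :=
  [set xi | forall x y, prec x y -> olt xi x y].

(* Main.v *)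
Require Import Defs.
From mathcomp Require Import all_boot all_order all_algebra.
From mathcomp Require Import all_classical all_reals all_analysis.
Set Implicit Arguments.
Unset Strict Implicit.
Unset Printing Implicit Defensive.
Import Order.TTheory GRing.Theory Num.Theory.
Local Open Scope classical_set_scope.

(** A linear extension of the universal poset must respect every finite chain of
    it, and a random order has little chance to do so. The set of all linear
    extensions is therefore covered, for each [n], by one cylinder: the orders
    that agree with [prec] on a chain of [n.+1] elements. Two facts make this
    cover a randomness test.

    Its measure tends to [0] effectively ([measure_cylinder_le]). The [n.+1]
    rotations of the chain define pairwise disjoint cylinders, since a total
    order sorts a finite set in a single way. Some permutation of [nat] carries
    each of them to the next, so they have the same measure by invariance, which
    is thus at most [1 / n.+1]. This is below [2 ^- k] once [2 ^ k <= n].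

    It is computable ([total_recursive_code_chain]). By homogeneity no element of
    the poset is minimal ([universal_poset_no_min]); starting from [0], an
    unbounded search for the first element below the last one found produces a
    descending chain from a program for [prec].

    There remains to index the cylinders in a recursive representation of the
    algebra ([recursive_representation_extend]). Finite unions of finite
    intersections of conditions on the relative order of two numbers form the
    whole algebra, and can be enumerated by decoding a number into a list of
    lists; the cylinders of the chains are interleaved with this enumeration.
    The computability claims rest on a small calculus showing that the operations
    on codes of lists are recursive. *)

(** * Calculus of recursive functions *)

(** Arguments are passed as an environment: the list holding the [k] values of
    the variables, read by [nth]. Binding a variable is then just [cons], and
    the closure properties below can be chained by unification, without casts
    between tuple types. Programs only see lists of length [k], whence the
    hypothesis of [eq_computable]. *)
Definition computable k (F : seq nat -> nat) : Prop :=
  exists p : recprog k, forall v : k.-tuple nat, receval p v (F v).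

Lemma eq_computable k (F F' : seq nat -> nat) :
  (forall v, size v = k -> F v = F' v) -> computable k F -> computable k F'.
Proof. by move=> FF' [p pP]; exists p => v; rewrite -FF' ?size_tuple. Qed.

Lemma computable_var k i : i < k -> computable k (fun v => nth 0 v i).
Proof.
move=> ik; exists (RProj (Ordinal ik)) => v.
by rewrite -(tnth_nth 0 v (Ordinal ik)); exact: eval_proj.
Qed.

Lemma computable_subst m k F (G : nat -> seq nat -> nat) :
  computable m F -> (forall i, i < m -> computable k (G i)) ->
  computable k (fun v => F (mkseq (G^~ v) m)).
Proof.
move=> [f fP] GP.
have /choice[g gP] (i : 'I_m) :
    exists q : recprog k, forall v : k.-tuple nat, receval q v (G i v).
  exact: GP.
exists (RComp f g) => v.
pose w : m.-tuple nat := Tuple (introT eqP (size_mkseq (G^~ v) m)).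
apply: (eval_comp (w := w)); last exact: fP.
by move=> i; rewrite (tnth_nth 0) nth_mkseq.
Qed.

Lemma total_recursive1P F :
  total_recursive1 F <-> computable 1 (fun v => F (nth 0 v 0)).
Proof.
split=> -[p pP]; exists p; last by move=> x; exact: pP.
move=> v; rewrite [v in receval _ v _](_ : v = [tuple nth 0 v 0]) //.
by apply: val_inj; case: v => -[|x []].
Qed.

Lemma total_recursive2P F :
  total_recursive2 F <-> computable 2 (fun v => F (nth 0 v 0) (nth 0 v 1)).
Proof.
split=> -[p pP]; exists p; last by move=> x y; exact: pP.
move=> v; rewrite [v in receval _ v _](_ : v = [tuple nth 0 v 0; nth 0 v 1]) //.
by apply: val_inj; case: v => -[|x [|y []]].
Qed.

Lemma computable1 k F G : total_recursive1 F -> computable k G ->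
  computable k (fun v => F (G v)).
Proof.
by move=> /total_recursive1P Fc Gc; apply: (computable_subst (G := fun=> G) Fc).
Qed.

Lemma computable2 k F G H : total_recursive2 F -> computable k G ->
  computable k H -> computable k (fun v => F (G v) (H v)).
Proof.
move=> /total_recursive2P Fc Gc Hc.
by apply: (computable_subst (G := fun i => if i is 0 then G else H) Fc) => -[].
Qed.

Lemma mkseq_consE k (x : nat) (v : seq nat) : size v = k ->
  mkseq (fun i => if i is j.+1 then nth 0 v j else x) k.+1 = x :: v.
Proof.
by move=> <-; rewrite /mkseq /= -[1]/(1 + 0) iotaDl -map_comp -[in RHS](mkseq_nth 0 v).
Qed.

(** Computing a local definition: [F] sees the value of [N] as a new variable
    placed in front of the environment. *)
Lemma computable_cons k F N : computable k.+1 F -> computable k N ->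
  computable k (fun v => F (N v :: v)).
Proof.
move=> Fc Nc.
pose G i := if i is j.+1 then nth 0 ^~ j else N.
apply: (eq_computable (F := fun v => F (mkseq (G^~ v) k.+1))) => [v sv|].
  by rewrite -(mkseq_consE _ sv); congr F; apply: eq_mkseq => -[].
apply: computable_subst => // -[//|i ik]; exact: computable_var.
Qed.

(** Primitive recursion inside an environment. In the body, the counter and the
    previous value are the variables 0 and 1, and [drop 2] gives back the
    surrounding environment. *)
Lemma computable_rec k F (G : nat -> nat -> seq nat -> nat) N :
  computable k F ->
  computable k.+2 (fun w => G (nth 0 w 0) (nth 0 w 1) (drop 2 w)) ->
  computable k N ->
  computable k (fun v => nat_rect (fun=> nat) (F v) (fun n y => G n y v) (N v)).
Proof.
move=> [f fP] [g gP] Nc.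
apply: (computable_cons (F := fun w => nat_rect (fun=> nat) (F (behead w))
   (fun n y => G n y (behead w)) (head 0 w)) _ Nc).
exists (RPrim f g) => w; rewrite (tuple_eta w) /=; set v := behead_tuple w.
rewrite (_ : [tuple of _] = cons_tuple (thead w) v); last exact: val_inj.
elim: (thead w) => [|n IH] /=; first exact/eval_prim0/fP.
by have := eval_primS IH (gP _); rewrite /= drop0.
Qed.

Lemma computable_drop n k F :
  computable k F -> computable (n + k) (fun w => F (drop n w)).
Proof.
move=> Fc; apply: (eq_computable (F := fun w =>
  F (mkseq (fun i => nth 0 w (n + i)) k))) => [w sw|].
  congr F; apply: (@eq_from_nth _ 0); rewrite size_mkseq ?size_drop ?sw ?addKn //.
  by move=> i ik; rewrite nth_mkseq // nth_drop.
by apply: computable_subst => // i ik; apply: computable_var; rewrite ltn_add2l.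
Qed.

(** Minimization searches for a zero, so [N v] is characterized as the first
    place where the test [b] fails. *)
Lemma computable_min k (b : seq nat -> bool) N :
  computable k.+1 b -> (forall v, size v = k -> ~~ b (N v :: v)) ->
  (forall v i, size v = k -> i < N v -> b (i :: v)) -> computable k N.
Proof.
move=> [f fP] Nb bN; exists (RMin f) => v.
apply: (eval_min (w := fun=> 0)) => [i iN|].
  by have := fP (cons_tuple i v); rewrite /= bN ?size_tuple.
by have := fP (cons_tuple (N v) v); rewrite /= (negbTE (Nb _ _)) ?size_tuple.
Qed.

Lemma computable_const k n : computable k (fun=> n).
Proof.
elim: n => [|n IH]; first by exists (RZero k) => v; exact: eval_zero.
by apply: (computable1 (F := succn)) IH; exists RSucc => x; exact: eval_succ.
Qed.

Lemma total_recursive_succn : total_recursive1 succn.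
Proof. by exists RSucc => x; exact: eval_succ. Qed.

Ltac var := exact: computable_var.

Lemma total_recursive_addn : total_recursive2 addn.
Proof.
apply/total_recursive2P; apply: (eq_computable (F := fun v =>
  nat_rect (fun=> nat) (nth 0 v 1) (fun _ y => succn y) (nth 0 v 0))) => [v _|].
  by elim: (nth 0 v 0) => //= n ->.
apply: computable_rec; try var.
by apply: (computable1 total_recursive_succn); var.
Qed.

Lemma total_recursive_double : total_recursive1 double.
Proof.
apply/total_recursive1P; apply: (eq_computable
  (F := fun v => addn (nth 0 v 0) (nth 0 v 0))) => [v _|]; first by rewrite addnn.
by apply: (computable2 total_recursive_addn); var.
Qed.

Lemma computable_if k (b : seq nat -> bool) A B :
  computable k b -> computable k A -> computable k B ->
  computable k (fun v => if b v then A v else B v).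
Proof.
move=> bc Ac Bc.
apply: (eq_computable (F := fun v => nat_rect (fun=> nat) (B v) (fun _ _ => A v) (b v))).
  by move=> v _; case: (b v).
by apply: computable_rec => //; exact: (computable_drop 2).
Qed.

Lemma computable_neg k (b : seq nat -> bool) :
  computable k b -> computable k (fun v => ~~ b v).
Proof.
move=> bc; apply: (eq_computable (F := fun v => if b v then 0 else 1)).
  by move=> v _; case: (b v).
by apply: computable_if => //; exact: computable_const.
Qed.

Lemma computable_pos k N : computable k N -> computable k (fun v => 0 < N v).
Proof.
move=> Nc; apply: (eq_computable (F := fun v => nat_rect (fun=> nat) 0
  (fun _ _ => 1) (N v))) => [v _|]; first by case: (N v).
by apply: computable_rec => //; exact: computable_const.
Qed.

Lemma total_recursive_odd : total_recursive1 (fun n => odd n).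
Proof.
apply/total_recursive1P; apply: (eq_computable (F := fun v => nat_rect (fun=> nat) 0
  (fun _ y => ~~ (0 < y)) (nth 0 v 0))) => [v _|].
  by elim: (nth 0 v 0) => //= n ->; case: odd.
apply: computable_rec; [exact: computable_const| |var].
by apply/computable_neg/computable_pos; var.
Qed.

Lemma total_recursive_half : total_recursive1 half.
Proof.
apply/total_recursive1P; apply: (eq_computable (F := fun v => nat_rect (fun=> nat) 0
  (fun n y => addn (odd n) y) (nth 0 v 0))) => [v _|].
  by elim: (nth 0 v 0) => //= n ->; rewrite uphalf_half.
apply: computable_rec; [exact: computable_const| |var].
apply: (computable2 total_recursive_addn); last var.
by apply: (computable1 total_recursive_odd); var.
Qed.

(** [cons_code], [head_code] and [tail_code] are the list operations read through
    [CodeSeq.code], by which [pickle] numbers nested lists. *)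
Definition cons_code x c := 2 ^ x * c.*2.+1.

Definition head_code c := head 0 (CodeSeq.decode c).

Definition tail_code c := CodeSeq.code (behead (CodeSeq.decode c)).

Lemma head_cons_code x c : head_code (cons_code x c) = x.
Proof.
by rewrite /head_code -[c]CodeSeq.decodeK (CodeSeq.codeK (x :: _)).
Qed.

Lemma tail_cons_code x c : tail_code (cons_code x c) = c.
Proof.
by rewrite /tail_code -[c in LHS]CodeSeq.decodeK (CodeSeq.codeK (x :: _)) CodeSeq.decodeK.
Qed.

Lemma computable_iter f k N M : total_recursive1 f ->
  computable k N -> computable k M -> computable k (fun v => iter (N v) f (M v)).
Proof.
move=> fr Nc Mc; apply: (eq_computable (F := fun v => nat_rect (fun=> nat) (M v)
  (fun _ y => f y) (N v))) => [v _|]; first by elim: (N v) => //= n ->.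
by apply: computable_rec => //; apply: (computable1 fr); var.
Qed.

Lemma total_recursive_cons_code : total_recursive2 cons_code.
Proof.
apply/total_recursive2P; apply: (eq_computable (F := fun v =>
  iter (nth 0 v 0) double (succn (double (nth 0 v 1))))) => [v _|].
  rewrite /cons_code; elim: (nth 0 v 0) => [|n /= ->]; first by rewrite mul1n.
  by rewrite expnS -mulnA mul2n.
apply: computable_iter; [exact: total_recursive_double|var|].
apply: (computable1 total_recursive_succn).
by apply: (computable1 total_recursive_double); var.
Qed.

Lemma total_recursive_exp2 : total_recursive1 (expn 2).
Proof.
apply/total_recursive1P.
apply: (eq_computable (F := fun v => cons_code (nth 0 v 0) 0)) => [v _|].
  by rewrite /cons_code muln1.
by apply: (computable2 total_recursive_cons_code); [var|exact: computable_const].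
Qed.

Lemma iter_half_exp2 j x m : iter j half (2 ^ (j + x) * m) = 2 ^ x * m.
Proof.
elim: j x => // j IH x.
by rewrite iterSr addSn expnS -mulnA mul2n doubleK IH.
Qed.

(** The code of [x :: s] is [2 ^ x] times an odd number: the head is the number of
    halvings after which an odd number first appears. The guard [0 < c] makes the
    search stop at once on the code of the empty list. *)
Lemma total_recursive_head_code : total_recursive1 head_code.
Proof.
pose b c j := (0 < c) && ~~ odd (iter j half c).
have halfE c j : 0 < c -> j <= head_code c ->
    iter j half c = 2 ^ (head_code c - j) * (tail_code c).*2.+1.
  move=> c0 jc; suff cE : c = 2 ^ (head_code c) * (tail_code c).*2.+1.
    by rewrite [in LHS]cE -{1}(subnKC jc) iter_half_exp2.
  rewrite /head_code /tail_code; case E: (CodeSeq.decode c) => [|x s].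
    by rewrite -(CodeSeq.decodeK c) E in c0.
  by rewrite -[LHS](CodeSeq.decodeK c) E.
apply/total_recursive1P; apply: (computable_min
  (b := fun w => b (nth 0 w 1) (nth 0 w 0))) => [|v _|v i _] /=.
- apply: (eq_computable (F := fun w => if 0 < nth 0 w 1
    then nat_of_bool (~~ odd (iter (nth 0 w 0) half (nth 0 w 1))) else 0)) => [w _|].
    by rewrite /b; case: ltnP.
  apply: computable_if; [apply: computable_pos; var| |exact: computable_const].
  apply/computable_neg/(computable1 total_recursive_odd).
  by apply: (computable_iter total_recursive_half); var.
- rewrite /b; case: posnP => //= c0.
  by rewrite halfE // subnn mul1n /= odd_double.
- rewrite /b; case: posnP => [->//|c0] ih /=.
  rewrite halfE //; last exact: ltnW.
  by rewrite -(subnSK ih) expnS -mulnA mul2n odd_double.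
Qed.

Lemma tail_code_half c : tail_code c = iter (head_code c).+1 half c.
Proof.
rewrite -{3}(CodeSeq.decodeK c) /head_code /tail_code.
case: (CodeSeq.decode c) => //= x s.
by rewrite -{2}[x]addn0 iter_half_exp2 mul1n /= uphalf_double.
Qed.

Lemma total_recursive_tail_code : total_recursive1 tail_code.
Proof.
apply/total_recursive1P; apply: (eq_computable (F := fun v =>
  iter (succn (head_code (nth 0 v 0))) half (nth 0 v 0))) => [v _|].
  by rewrite tail_code_half.
apply: (computable_iter total_recursive_half); last var.
apply: (computable1 total_recursive_succn).
by apply: (computable1 total_recursive_head_code); var.
Qed.

Lemma size_code s : size s <= CodeSeq.code s.
Proof.
elim: s => //= x s IH; apply: leq_trans (leq_pmull _ _); last by rewrite expn_gt0.
by rewrite ltnS -addnn (leq_trans IH) ?leq_addr.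
Qed.

(** The list is traversed from its head while the result is built by [cons_code],
    hence the reversal. It does no harm: the lists coded here stand for finite
    unions and intersections. *)
Definition map_code f c := CodeSeq.code (rev (map f (CodeSeq.decode c))).

Lemma total_recursive_map_code f :
  total_recursive1 f -> total_recursive1 (map_code f).
Proof.
move=> fr.
pose step c t a := if 0 < iter t tail_code c
  then cons_code (f (head_code (iter t tail_code c))) a else a.
apply/total_recursive1P; apply: (eq_computable (F := fun v =>
  nat_rect (fun=> nat) 0 (step (nth 0 v 0)) (nth 0 v 0))) => [v _|].
  move: (nth 0 v 0) => c; rewrite /map_code; set s := CodeSeq.decode c.
  (* The bound [c] on the number of steps is large enough by [size_code]; the
     idle steps find [0], the code of the empty list, and leave [a] alone. *)
  have tailE t : iter t tail_code c = CodeSeq.code (drop t s).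
    elim: t => [|t IH]; first by rewrite drop0 CodeSeq.decodeK.
    by rewrite iterS IH /tail_code CodeSeq.codeK -drop1 drop_drop add1n.
  have recE t : nat_rect (fun=> nat) 0 (step c) t =
      CodeSeq.code (rev (map f (take t s))).
    elim: t => [|t /= ->]; first by rewrite take0.
    rewrite /step tailE; have [ts|st] := ltnP t (size s).
      rewrite (take_nth 0 ts) map_rcons rev_rcons (drop_nth 0 ts).
      by rewrite /head_code CodeSeq.codeK muln_gt0 expn_gt0.
    by rewrite drop_oversize // !take_oversize // ltnW.
  by rewrite recE take_oversize // -[X in _ <= X](CodeSeq.decodeK c) size_code.
apply: computable_rec; [exact: computable_const| |var].
have tc : computable 3 (fun w => iter (nth 0 w 0) tail_code (nth 0 (drop 2 w) 0)).
  apply: (computable_iter total_recursive_tail_code); first var.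
  exact: (computable_drop 2 (computable_var (ltnSn 0))).
apply: computable_if; [exact: computable_pos| |var].
apply: (computable2 total_recursive_cons_code); last var.
exact/(computable1 fr)/(computable1 total_recursive_head_code).
Qed.

(** * Computable enumeration of the cylinder algebra *)

(** By transitivity, it suffices to compare consecutive elements of [l]. *)
Lemma cylinderP (l : fin_order) (xi : orders) :
  cylinder l xi <-> sorted (olt xi) (val l).
Proof.
have [ir tr _] := oltP xi; case: l => l ul /=; split=> [lxi|sl x y xl yl].
  apply/(sortedP 0) => i il; have il' := ltnW il.
  by rewrite lxi ?mem_nth // !index_uniq.
have lt_olt := sorted_ltn_index tr sl.
have [xy|yx|xy] := ltngtP (index x l) (index y l).
- exact: lt_olt.
- by apply: contraFF (ir x) => /tr; apply; exact: lt_olt.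
- by rewrite -(nth_index 0 xl) xy nth_index.
Qed.

Lemma denoteP (e : expression) (xi : orders) :
  denote e xi <-> exists2 c, c \in e & forall a, a \in c -> literal a xi.
Proof.
rewrite /denote -bigcup_seq; split=> -[c /= ce cxi]; exists c => //.
  by move: cxi; rewrite -bigcap_seq.
by rewrite -bigcap_seq.
Qed.

Lemma edge_uniq x d : uniq [:: x; (x + d).+1].
Proof. by rewrite /= inE neq_ltn ltnS leq_addr. Qed.

(** Writing a pair [x < y] as [(x, y - x - 1)] makes every pair of numbers
    acceptable, so that no test is needed to enumerate these orders. *)
Definition edge x d : fin_order :=
  exist (fun l : seq nat => uniq l) _ (edge_uniq x d).

(** A computable enumeration of all literals on two-element orders: the parity
    gives the sign, and the half codes the order. *)
Definition edge_literal k : fin_order * bool :=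
  (edge (head_code k./2) (tail_code k./2), odd k).

Definition edge_set k : set orders := literal (edge_literal k).

Lemma edge_set_cons_code x d (b : bool) :
  edge_set (b + (cons_code x d).*2) = literal (edge x d, b).
Proof.
rewrite /edge_set /edge_literal half_bit_double oddD odd_double addbF oddb.
by rewrite head_cons_code tail_cons_code.
Qed.

Lemma edge_setC k : exists k', edge_set k' = ~` edge_set k.
Proof.
exists (~~ odd k + k./2.*2); rewrite /edge_set /edge_literal.
rewrite half_bit_double oddD odd_double addbF oddb /literal /=.
by case: odd => //=; rewrite setCK.
Qed.

(** When [y < x], the condition that [x] precedes [y] is the negation of a
    literal [edge y _], as the orders are total. *)
Lemma edge_set_olt x y : x != y -> exists k, edge_set k = [set xi | olt xi x y].
Proof.
have edgeE a b xi : cylinder (edge a b) xi <-> olt xi a (a + b).+1.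
  by rewrite cylinderP /= andbT.
rewrite neq_ltn => /orP[xy|yx].
  exists (true + (cons_code x (y - x.+1)).*2); rewrite edge_set_cons_code.
  by apply/seteqP; split=> xi; rewrite /literal /= edgeE -addSn subnKC.
exists (false + (cons_code y (x - y.+1)).*2); rewrite edge_set_cons_code.
apply/seteqP; split=> xi; rewrite /literal /= edgeE -addSn subnKC //;
  have [ir tr cr] := oltP xi.
  by move=> /negP nyx; have := cr x y; rewrite (negbTE nyx) orbF neq_ltn yx orbT; apply.
by move=> xy yx'; have := tr _ _ _ xy yx'; rewrite ir.
Qed.

Definition edge_expression (ls : seq (seq nat)) : expression :=
  [seq [seq edge_literal k | k <- c] | c <- ls].

Lemma edge_expressionP ls xi : denote (edge_expression ls) xi <->
  exists2 c, c \in ls & forall k, k \in c -> edge_set k xi.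
Proof.
rewrite denoteP; split=> [[_ /mapP[c cls ->] cxi]|[c cls cxi]].
  by exists c => // k kc; apply/cxi/map_f.
exists [seq edge_literal k | k <- c]; first exact: map_f.
by move=> _ /mapP[k kc ->]; exact: cxi.
Qed.

(** Literals on two-element orders already generate the algebra. These sets are
    shown to form an algebra containing the cylinders, hence to exhaust it. *)
Definition edge_definable (A : set orders) := exists ls, A = denote (edge_expression ls).

Lemma edge_definable_edge k : edge_definable (edge_set k).
Proof.
exists [:: [:: k]]; apply/seteqP; split=> xi.
  move=> kxi; apply/edge_expressionP; exists [:: k]; rewrite ?mem_head //.
  by move=> _ /[!inE] /eqP->.
by move=> /edge_expressionP[c] /[!inE] /eqP-> /(_ _ (mem_head _ _)).
Qed.

Lemma edge_definable0 : edge_definable set0.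
Proof.
by exists [::]; apply/seteqP; split=> xi // /edge_expressionP[].
Qed.

Lemma edge_definableT : edge_definable setT.
Proof.
exists [:: [::]]; apply/seteqP; split=> xi // _.
by apply/edge_expressionP; exists [::].
Qed.

Lemma edge_definableU A B :
  edge_definable A -> edge_definable B -> edge_definable (A `|` B).
Proof.
move=> [ls ->] [ms ->]; exists (ls ++ ms).
by rewrite /denote /edge_expression map_cat big_cat.
Qed.

Lemma edge_definableI A B :
  edge_definable A -> edge_definable B -> edge_definable (A `&` B).
Proof.
move=> [ls ->] [ms ->]; exists [seq l ++ m | l <- ls, m <- ms].
apply/seteqP; split=> xi.
  move=> [/edge_expressionP[l lls lxi] /edge_expressionP[m mms mxi]].
  apply/edge_expressionP; exists (l ++ m); first exact: allpairs_f.
  by move=> k /[!mem_cat] /orP[/lxi|/mxi].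
move=> /edge_expressionP[_ /allpairsP[[l m] [/= lls mms ->]] xiP].
by split; apply/edge_expressionP; [exists l|exists m] => // k kl;
  apply: xiP; rewrite mem_cat kl ?orbT.
Qed.

Lemma edge_definableC A : edge_definable A -> edge_definable (~` A).
Proof.
move=> [ls ->]; elim: ls => [|l ls IH].
  by rewrite /denote big_nil setC0; exact: edge_definableT.
rewrite /denote /edge_expression /= big_cons setCU.
apply: edge_definableI IH; elim: l => [|k l IH].
  by rewrite big_nil setCT; exact: edge_definable0.
rewrite /= big_cons setCI; apply: edge_definableU IH.
by have [k' <-] := edge_setC k; exact: edge_definable_edge.
Qed.

Lemma edge_definable_cylinder l : edge_definable (cylinder l).
Proof.
rewrite (_ : cylinder l = [set xi | sorted (olt xi) (val l)]); last first.
  by apply/seteqP; split=> xi /cylinderP.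
elim: (val l) (valP l) => [|x [|y s] IH] u.
- have -> : [set xi | sorted (olt xi) [::]] = setT by apply/seteqP.
  exact: edge_definableT.
- have -> : [set xi | sorted (olt xi) [:: x]] = setT by apply/seteqP.
  exact: edge_definableT.
have /andP[/= /[!inE] /norP[xy _] us] : uniq (x :: y :: s) := u.
rewrite (_ : mkset _ =
  [set xi | olt xi x y] `&` [set xi | sorted (olt xi) (y :: s)]).
  apply: edge_definableI (IH us).
  by have [k <-] := edge_set_olt xy; exact: edge_definable_edge.
by apply/seteqP; split=> xi /= /andP.
Qed.

Lemma set_algebra_cyl_algebra : set_algebra cyl_algebra.
Proof.
split; first split.
- by move=> M [[[M0 _ _] _] _].
- by move=> A B Ac Bc M MP; have [[[_ MU _] _] _] := MP; apply: MU; [exact: Ac|exact: Bc].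
- by move=> A B Ac Bc M MP; have [[[_ _ MD] _] _] := MP; apply: MD; [exact: Ac|exact: Bc].
by move=> M [[_ MT] _].
Qed.

Lemma cyl_algebra_denote e : cyl_algebra (denote e).
Proof.
have [[c0 cU cD] cT] := set_algebra_cyl_algebra.
have cC A : cyl_algebra A -> cyl_algebra (~` A) by move=> Ac; rewrite -setTD; exact: cD.
have cI A B : cyl_algebra A -> cyl_algebra B -> cyl_algebra (A `&` B).
  by move=> Ac Bc; rewrite -[A `&` B]setCK setCI; apply: (cC); apply: (cU); exact: cC.
apply: (big_ind cyl_algebra) => // c _; apply: (big_ind cyl_algebra) => // a _.
have cl : cyl_algebra (cylinder a.1) by apply: sub_gen_smallest; exists a.1.
by rewrite /literal; case: a.2 => //; exact: cC.
Qed.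

Lemma edge_definable_cyl_algebra A : cyl_algebra A -> edge_definable A.
Proof.
apply: smallest_sub => [|_ [l _ <-]]; last exact: edge_definable_cylinder.
split; last exact: edge_definableT.
split; [exact: edge_definable0|exact: edge_definableU|move=> B C Bd Cd].
by rewrite setDE; apply/edge_definableI/edge_definableC.
Qed.

(** Decoding is a bijection from numbers to lists of numbers; applied twice, it
    enumerates all lists of lists of edge literals. *)
Definition all_clauses c := rev [seq edge_literal k | k <- CodeSeq.decode c].

Definition all_expressions i : expression :=
  rev [seq all_clauses c | c <- CodeSeq.decode i].

Lemma all_expressions_surj ls : exists i, all_expressions i = edge_expression ls.
Proof.
exists (CodeSeq.code (rev [seq CodeSeq.code (rev c) | c <- ls])).
rewrite /all_expressions CodeSeq.codeK map_rev revK -map_comp.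
by apply: eq_map => c; rewrite /all_clauses /= CodeSeq.codeK map_rev revK.
Qed.

Lemma total_recursive_all_expressions :
  total_recursive1 (fun i => pickle (all_expressions i)).
Proof.
have -> : (fun i => pickle (all_expressions i)) =
    map_code (map_code (fun k => pickle (edge_literal k))).
  have mapE (T : countType) (f : nat -> T) c :
      pickle (rev [seq f k | k <- CodeSeq.decode c]) = map_code (pickle \o f) c.
    by rewrite /map_code map_comp -(map_rev pickle).
  apply/funext => i; rewrite /all_expressions mapE; congr (map_code _ i).
  by apply/funext => c; exact: mapE.
do 2!apply: total_recursive_map_code.
apply/total_recursive1P; apply: (eq_computable (F := fun v =>
  let x := head_code (nth 0 v 0)./2 in let d := tail_code (nth 0 v 0)./2 in
  cons_code (cons_code x (cons_code (succn (addn x d)) 0))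
    (cons_code (odd (nth 0 v 0)) 0))) => [v _ //|].
have hc : computable 1 (fun v => (nth 0 v 0)./2).
  by apply: (computable1 total_recursive_half); var.
have xc := computable1 total_recursive_head_code hc.
have dc := computable1 total_recursive_tail_code hc.
have nilc k := computable_const k 0.
apply: (computable2 total_recursive_cons_code).
  apply: (computable2 total_recursive_cons_code) => //.
  apply: (computable2 total_recursive_cons_code) => //.
  apply: (computable1 total_recursive_succn).
  exact: (computable2 total_recursive_addn).
apply: (computable2 total_recursive_cons_code) => //.
by apply: (computable1 total_recursive_odd); var.
Qed.

(** The definition of randomness lets the test choose its representation of the
    algebra. Interleaving a given computable family with an enumeration of the
    whole algebra makes the indices of the family trivially computable. *)
Lemma recursive_representation_extend (E : nat -> expression) :
  total_recursive1 (fun i => pickle (E i)) ->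
  exists T, recursive_representation T /\ forall n, T n.*2 = denote (E n).
Proof.
move=> Er; pose E' i := if odd i then all_expressions i./2 else E i./2.
exists (denote \o E'); split; last first.
  by move=> n; rewrite /E' /= odd_double doubleK.
split; last first.
  exists E'; split=> //; apply/total_recursive1P.
  have hc : computable 1 (fun v => (nth 0 v 0)./2).
    by apply: (computable1 total_recursive_half); var.
  apply: (eq_computable (F := fun v => if odd (nth 0 v 0)
    then pickle (all_expressions (nth 0 v 0)./2) else pickle (E (nth 0 v 0)./2))).
    by move=> v _; rewrite /E'; case: odd.
  apply: computable_if.
  - by apply: (computable1 total_recursive_odd); var.
  - exact: (computable1 total_recursive_all_expressions).
  - exact: (computable1 Er).
apply/seteqP; split=> [_ [i _ <-]|A /edge_definable_cyl_algebra[ls ->]].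
  exact: cyl_algebra_denote.
have [i <-] := all_expressions_surj ls; exists i.*2.+1 => //=.
by rewrite /E' /= odd_double uphalf_double.
Qed.

(** * Measure of cylinders *)

Lemma open_olt x y : open [set xi : orders | olt xi x y].
Proof.
rewrite /olt /ltr_of; case: insubP => [p _ _|_]; last first.
  have -> : [set _ : orders | false] = set0 by apply/seteqP; split. exact: open0.
have -> : [set xi : orders | set_val xi p] =
    (fun xi : orders => set_val xi : {ptws npair -> bool}) @^-1`
      ((fun f : {ptws npair -> bool} => f p) @^-1` [set true]) by [].
apply: open_comp => [xi _|].
  exact: (@initial_continuous orders {ptws npair -> bool} set_val).
apply: open_comp => [f _|]; last exact: discrete_open.
exact: (@proj_continuous npair (fun=> bool) p f).
Qed.

Lemma measurable_cylinder l : measurable (cylinder l : set borel_orders).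
Proof.
have -> : cylinder l = [set xi | sorted (olt xi) (val l)].
  by apply/seteqP; split=> xi /cylinderP.
elim: (val l) => [|x [|y s] IH].
- have -> : [set xi | sorted (olt xi) [::]] = setT by apply/seteqP.
  exact: measurableT.
- have -> : [set xi | sorted (olt xi) [:: x]] = setT by apply/seteqP.
  exact: measurableT.
have -> : [set xi | sorted (olt xi) [:: x, y & s]] =
    [set xi | olt xi x y] `&` [set xi | sorted (olt xi) (y :: s)].
  by apply/seteqP; split=> xi /= /andP.
by apply: measurableI IH; apply: sub_sigma_algebra; exact: open_olt.
Qed.

Lemma sinf_of_can (f g : nat -> nat) : cancel f g -> cancel g f ->
  exists s : Sinf, s =1 f.
Proof.
move=> fK gK; have fb : bijective f by exists g.
by have [s ->] := PbijTT fb; exists s.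
Qed.

Lemma olt_act (s : Sinf) xi x y : olt (act s xi) (s x) (s y) = olt xi x y.
Proof.
have [ir _ _] := oltP (act s xi).
rewrite /olt of_relK; last by move=> z; have [i _ _] := oltP xi; exact: i.
by rewrite !funK ?inE.
Qed.

Lemma orders_ext (xi zeta : orders) : olt xi =2 olt zeta -> xi = zeta.
Proof.
move=> xz; apply: val_inj; apply/funext => p.
by have := xz (val p).1 (val p).2; rewrite /olt /ltr_of -surjective_pairing valK.
Qed.

(** The preimage of an order under [act s] is its image under the inverse
    permutation. *)
Lemma act_cylinder (s : Sinf) (l l' : fin_order) :
  val l' = map s (val l) -> act s @` cylinder l = cylinder l'.
Proof.
move=> l'E; have actE xi : cylinder l' (act s xi) <-> cylinder l xi.
  by rewrite !cylinderP l'E sorted_map (eq_sorted (olt_act s xi)).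
apply/seteqP; split=> [_ [xi lxi <-]|xi l'xi]; first exact/actE.
have sK : cancel s s^-1%FUN by move=> x; rewrite funK ?inE.
have Ks : cancel s^-1%FUN s by move=> x; rewrite invK ?inE.
have [t tE] := sinf_of_can Ks sK.
have stK : act s (act t xi) = xi.
  apply: orders_ext => x y.
  by rewrite -(Ks x) -(Ks y) olt_act -!tE olt_act !tE !Ks.
by exists (act t xi) => //; apply/actE; rewrite stK.
Qed.

(** [next s] permutes [nat], cyclically on [s] and trivially elsewhere, so that
    one step of rotation comes from an element of [Sinf]. *)
Lemma map_next (s : seq nat) : uniq s -> map (next s) s = rot 1 s.
Proof.
move=> us; apply: (@eq_from_nth _ 0); rewrite size_map ?size_rot // => i si.
rewrite (nth_map 0) // next_nth mem_nth //.
case: s us si => [//|y s] us si; rewrite index_uniq // rot1_cons nth_rcons.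
have [si'|si'|->] := ltngtP i (size s); first exact: set_nth_default.
  by move: si; rewrite ltnNge /= si'.
by rewrite nth_default.
Qed.

Definition rot_order i (l : fin_order) : fin_order :=
  exist (fun s : seq nat => uniq s) (rot i (val l))
    (etrans (rot_uniq i (val l)) (valP l)).

Lemma measure_rot_order (R : realType) (mu : probability borel_orders R) i l :
  glasner_weiss mu ->
  mu (cylinder (rot_order i l)) = mu (cylinder l).
Proof.
move=> mu_gw; have rot1 (m m' : fin_order) : val m' = rot 1 (val m) ->
    mu (cylinder m') = mu (cylinder m).
  move=> m'E; have um := valP m.
  have [s sE] := sinf_of_can (prev_next um) (next_prev um).
  rewrite -(@act_cylinder s m) ?mu_gw //; first exact: measurable_cylinder.
  by rewrite m'E (eq_map sE) map_next.
elim: i => [|i IH]; first by congr (mu (cylinder _)); apply: val_inj; exact: rot0.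
have [il|li] := ltnP i (size (val l)).
  by rewrite -IH; apply: rot1; rewrite /= rotS.
congr (mu (cylinder _)); apply: val_inj; rewrite /= rot_oversize //.
exact: leqW.
Qed.

(** A total order sorts a given set of numbers in one way only, and distinct
    rotations of a duplicate-free list begin with distinct elements. *)
Lemma rot_order_disjoint l i j xi : i < size (val l) -> j < size (val l) ->
  cylinder (rot_order i l) xi -> cylinder (rot_order j l) xi -> i = j.
Proof.
move=> il jl /cylinderP/= si /cylinderP/= sj; have [ir tr _] := oltP xi.
have ij : rot i (val l) = rot j (val l).
  by apply: (irr_sorted_eq tr ir si sj) => x; rewrite !mem_rot.
have hd k : k < size (val l) -> nth 0 (rot k (val l)) 0 = nth 0 (val l) k.
  by move=> kl; rewrite nth_cat size_drop subn_gt0 kl nth_drop addn0.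
by apply/eqP; rewrite -(nth_uniq 0 il jl (valP l)) -!hd // ij.
Qed.

(** The exact value is the inverse of the factorial of the size, obtained from
    all permutations of [l]; its rotations alone give a bound that tends to [0]
    and requires less counting. *)
Lemma measure_cylinder_le (R : realType) (mu : probability borel_orders R) l :
  glasner_weiss mu -> 0 < size (val l) ->
  (mu (cylinder l) <= ((size (val l))%:R^-1)%R%:E)%E.
Proof.
move=> mu_gw; set n := size _ => n0; have ml := measurable_cylinder l.
pose F (i : 'I_n) : set borel_orders := cylinder (rot_order i l).
have mF i : measurable (F i) by exact: measurable_cylinder.
have tF : trivIset setT F.
  move=> i j _ _ [xi [xii xij]]; apply: val_inj.
  exact: (@rot_order_disjoint l i j xi).
have : (mu (\big[setU/set0]_(i < n) F i) <= 1)%E.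
  by apply: probability_le1; exact: bigsetU_measurable.
rewrite (@measure_bigsetU_ord _ _ _ mu n xpredT) //.
rewrite (eq_bigr (fun=> mu (cylinder l))); last first.
  by move=> i _; exact: measure_rot_order.
rewrite -(fineK (fin_num_measure mu _ ml)) sumEFin !lee_fin sumr_const card_ord.
by rewrite -(mulr_natr (fine _)) -ler_pdivlMr ?ltr0n // mul1r.
Qed.

(** * Descending chains in the universal poset *)

(** The poset contains some two-element chain, and homogeneity moves the top of
    this chain to [x]. *)
Lemma universal_poset_no_min prec x :
  universal_poset prec -> exists y, prec y x.
Proof.
move=> [[ir _] hom emb]; have [f [_ fP]] := emb _ 'I_2.
have [||s [sP sx]] := hom [:: f ord_max] (fun=> x).
- by move=> y z /[!inE] /eqP-> /eqP->.
- by move=> y z /[!inE] /eqP-> /eqP->; rewrite !ir.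
exists (s (f ord0)); rewrite -(sx (f ord_max)) ?mem_head //.
by rewrite sP fP.
Qed.

Definition below (prec : rel nat) (no_min : forall x, exists y, prec y x) x :=
  ex_minn (no_min x).

(** Going downwards adds each new element at the head, which is both where
    [cons_code] puts it and where the increasing order wants it. *)
Definition chain (prec : rel nat) (no_min : forall x, exists y, prec y x) n :=
  iter n (fun s => below no_min (head 0 s) :: s) [:: 0].

Lemma size_chain (prec : rel nat) (no_min : forall x, exists y, prec y x) n :
  size (chain no_min n) = n.+1.
Proof. by elim: n => //= n ->. Qed.

Lemma sorted_chain (prec : rel nat) (no_min : forall x, exists y, prec y x) n :
  sorted prec (chain no_min n).
Proof.
elim: n => //= n; case: (chain no_min n) => //= x s ->.
by rewrite andbT /below; case: ex_minnP.
Qed.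

Lemma total_recursive_below (prec : rel nat)
    (no_min : forall x, exists y, prec y x) :
  recursive_rel prec -> total_recursive1 (below no_min).
Proof.
move=> prec_rec; apply/total_recursive1P; apply: (computable_min
  (b := fun w => ~~ prec (nth 0 w 0) (nth 0 w 1))) => [|v _|v i _] /=.
- by apply/computable_neg/(computable2 prec_rec); var.
- by rewrite negbK /below; case: ex_minnP.
- rewrite /below; case: ex_minnP => m _ mmin im.
  by apply: contraL im => /mmin; rewrite leqNgt.
Qed.

Lemma total_recursive_code_chain (prec : rel nat)
    (no_min : forall x, exists y, prec y x) :
  recursive_rel prec ->
  total_recursive1 (fun n => CodeSeq.code (chain no_min n)).
Proof.
move=> prec_rec; apply/total_recursive1P; apply: (eq_computable (F := fun v =>
  nat_rect (fun=> nat) (cons_code 0 0)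
    (fun _ c => cons_code (below no_min (head_code c)) c) (nth 0 v 0))) => [v _|].
  elim: (nth 0 v 0) => //= n ->; rewrite /head_code CodeSeq.codeK.
  by rewrite /cons_code.
apply: computable_rec; [exact: computable_const| |var].
apply: (computable2 total_recursive_cons_code); last var.
apply: (computable1 (total_recursive_below no_min prec_rec)).
by apply: (computable1 total_recursive_head_code); var.
Qed.

Theorem theorem6 (R : realType) (mu : probability borel_orders R)
  (mu_gw : glasner_weiss mu)
  (prec : rel nat) (prec_universal : universal_poset prec)
  (prec_rec : recursive_rel prec) :
  martin_lof_random mu `&` linear_extensions prec = set0.
Proof.
apply/seteqP; split=> // xi [xi_random]; apply: xi_random => {xi}.
have [[ir tr] _ _] := prec_universal.
have no_min x := universal_poset_no_min x prec_universal.
pose l n : fin_order := exist (fun s : seq nat => uniq s) (chain no_min n)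
  (sorted_uniq tr ir (sorted_chain no_min n)).
pose E n : expression := [:: [:: (l n, true)]].
have denoteE n : denote (E n) = cylinder (l n).
  by rewrite /denote !big_seq1.
have Er : total_recursive1 (fun n => pickle (E n)).
  apply/total_recursive1P; apply: (eq_computable (F := fun v =>
    cons_code (cons_code (cons_code (CodeSeq.code (chain no_min (nth 0 v 0)))
      (cons_code 1 0)) 0) 0)) => [v _|].
    by rewrite -[chain no_min _]map_id.
  (* The code of a boolean [true] is [1], and [cons_code 1 0] codes [:: 1]. *)
  do 3 (apply: (computable2 total_recursive_cons_code);
    last exact: computable_const).
  by apply: (computable1 (total_recursive_code_chain no_min prec_rec)); var.
have [T [Trep TE]] := recursive_representation_extend Er.
have UE n : \bigcup_(_ in [set: nat]) T n.*2 = cylinder (l n).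
  by rewrite TE denoteE; apply/seteqP; split=> [xi []|xi lxi] //; exists 0.
exists T; split=> //; exists (fun n _ => n.*2); split.
- apply/total_recursive2P.
  by apply: (computable1 total_recursive_double); var.
- move=> xi xi_ext n _; rewrite UE; apply/cylinderP.
  exact: (sub_sorted xi_ext (sorted_chain no_min n)).
exists (expn 2); split; first exact: total_recursive_exp2.
move=> k n kn; rewrite UE.
apply: le_lt_trans (measure_cylinder_le mu_gw _) _; rewrite /= size_chain //.
rewrite lte_fin ltf_pV2 ?posrE ?ltr0n ?exprn_gt0 //.
by rewrite -natrX ltr_nat ltnS.
Qed.
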